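(* Let $R$ be a finite Frobenius ring, let $n$ be a positive integer, and let $C\leq {}_RR^n$ be a modular (left linear) two-weight code with nonzero homogeneous weights $w_1<w_2$. Let $C_0=\{\mathbf{c}\in C;\ \mathrm{w}_{\mathrm{hom}}(\mathbf{c})=0\}$. Then the graph $\Gamma(C)$ is strongly regular with parameters $(N,K,\lambda,\mu)$ given by $$N=\frac{|C|}{|C_0|},\qquad K=\frac{(w_2-n)N-w_2}{w_2-w_1},$$ $$\lambda=\frac{K\left(\frac{w_1^2}{n}-2w_1\right)+w_2(K-1)}{w_2-w_1},\qquad \mu=\frac{K\left(\frac{w_1w_2}{n}-w_1-w_2\right)+w_2K}{w_2-w_1}.$$ Moreover, the graph $\Gamma(C)$ is trivial if and only if $w_1=n$.
   Context: Rings are associative with $1$; $R^\times$ is the group of units. A finite ring $R$ is a Frobenius ring if there is a character $\chi\in\mathrm{Hom}_{\mathbb{Z}}(R,\mathbb{C}^\times)$ of $(R,+)$ whose kernel contains no nonzero left (or right) ideal of $R$. The (normalized) homogeneous weight $\mathrm{w}_{\mathrm{hom}}\colon R\to\mathbb{C}$ is $\mathrm{w}_{\mathrm{hom}}(x)=1-\frac{1}{|R^\times|}\sum_{u\in R^\times}\chi(ux)$ (independent of the choice of such $\chi$; its values are real and nonnegative). It is extended to $R^n$ by $\mathrm{w}_{\mathrm{hom}}(\mathbf{x})=\sum_{j=1}^n\mathrm{w}_{\mathrm{hom}}(x_j)$. A left linear code is a left submodule $C\leq{}_RR^n$. A two-weight code is a linear code for which $\mathrm{w}_{\mathrm{hom}}$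 takes exactly two nonzero values $w_1<w_2$ on $C$. Put $C_0=\{\mathbf{c}\in C;\mathrm{w}_{\mathrm{hom}}(\mathbf{c})=0\}$ and $C_i=\{\mathbf{c}\in C;\mathrm{w}_{\mathrm{hom}}(\mathbf{c})=w_i\}$ for $i=1,2$. The set $C_0$ is a subgroup of $(C,+)$, and $C_1,C_2$ are unions of cosets of $C_0$. Modular codes: let $C\leq{}_RR^n$ have no all-zero coordinate (for each $j$ some codeword has nonzero $j$-th entry), and write $C=\{\mathbf{x}\mathbf{G};\mathbf{x}\in R^k\}$ with $\mathbf{G}=(\mathbf{g}_1|\dots|\mathbf{g}_n)\in R^{k\times n}$. For a nonzero cyclic right submodule $\mathbf{g}R$ of $R^k_R$ (a ''point'') let $\alpha_C(\mathbf{g}R)=|\{j;\ \mathbf{g}_jR=\mathbf{g}R\}|$. The code $C$ is modular of index $r\in\mathbb{Q}$ if for every point $\mathbf{g}R$ either $\alpha_C(\mathbf{g}R)=0$ or $\alpha_C(\mathbf{g}R)=r\,|\mathbf{g}R^\times|$. (This does not depend on the choice of $k$ and $\mathbf{G}$.) The graph $\Gamma(C)$ has as vertices the cosets of $C_0$ in $C$; two cosets $\mathbf{c}+C_0$ and $\mathbf{d}+C_0$ are adjacent iff $\mathrm{w}_{\mathrm{hom}}(\mathbf{c}-\mathbf{d})=w_1$ (well defined). A simple graph is strongly regular with parameters $(N,K,\lambda,\mu)$ if it has $N$ vertices, is regular of degree $K$, and any two adjacent (resp. distinct nonadjacent) vertices have exactly $\lambda$ (resp. $\mu$) common neighbours.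 It is called trivial if it or its complement is a disjoint union of cliques of the same size. *)

(* Defs.v *)
From HB Require Import structures.
From mathcomp Require Import all_boot all_order all_algebra.

Set Implicit Arguments.
Unset Strict Implicit.
Unset Printing Implicit Defensive.

Import Order.TTheory GRing.Theory Num.Theory.
Local Open Scope ring_scope.

(* [F] plays the role of the complex numbers: any [numClosedFieldType] is
   allowed (e.g. [algC], or [R[i]] for a real closed field [R]).  Its order is
   the partial order in which [x < y] iff [y - x] is a positive real. *)

Definition left_ideal (R : finUnitRingType) (I : {set R}) : Prop :=
  zmod_closed I /\ (forall a x, x \in I -> a * x \in I).

Definition right_ideal (R : finUnitRingType) (I : {set R}) : Prop :=
  zmod_closed I /\ (forall a x, x \in I -> x * a \in I).

Definition additive_character (F : numClosedFieldType) (R : finUnitRingType)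
    (chi : R -> F) : Prop :=
  (forall x, chi x != 0) /\ (forall x y, chi (x + y) = chi x * chi y).

Definition char_ker (F : numClosedFieldType) (R : finUnitRingType)
    (chi : R -> F) : {set R} := [set x | chi x == 1].

(* For finite rings the left and the right condition are equivalent; either
   one is accepted here. *)
Definition generating_character (F : numClosedFieldType) (R : finUnitRingType)
    (chi : R -> F) : Prop :=
  additive_character chi /\
  ((forall I, left_ideal I -> I \subset char_ker chi -> I = [set 0]) \/
   (forall I, right_ideal I -> I \subset char_ker chi -> I = [set 0])).

Definition frobenius_ring (F : numClosedFieldType) (R : finUnitRingType) : Prop :=
  exists chi : R -> F, generating_character chi.

Definition runits (R : finUnitRingType) : {set R} :=
  [set u : R | u \is a GRing.unit].

Definition whom (F : numClosedFieldType) (R : finUnitRingType)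
    (chi : R -> F) (x : R) : F :=
  1 - (#|runits R|%:R)^-1 * \sum_(u in runits R) chi (u * x).

Definition whomv (F : numClosedFieldType) (R : finUnitRingType) (n : nat)
    (chi : R -> F) (x : 'rV[R]_n) : F :=
  \sum_(j < n) whom chi (x 0 j).

(* ['rV[R]_n] is a left [R]-module, so [submod_closed] means left submodule. *)
Definition linear_code (R : finUnitRingType) (n : nat) (C : {set 'rV[R]_n}) :
    Prop := submod_closed C.

Definition two_weight_code (F : numClosedFieldType) (R : finUnitRingType)
    (n : nat) (chi : R -> F) (C : {set 'rV[R]_n}) (w1 w2 : F) : Prop :=
  [/\ linear_code C,
      w1 < w2,
      w1 != 0 /\ w2 != 0 &
      forall w : F, w != 0 ->
        (exists2 c, c \in C & whomv chi c = w) <-> (w = w1 \/ w = w2)].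

Definition colscale (R : finUnitRingType) (k : nat) (g : 'cV[R]_k) (a : R) :
    'cV[R]_k := \col_i (g i 0 * a).

Definition cyclic_submod (R : finUnitRingType) (k : nat) (g : 'cV[R]_k) :
    {set 'cV[R]_k} := [set colscale g a | a : R].

Definition unit_orbit (R : finUnitRingType) (k : nat) (g : 'cV[R]_k) :
    {set 'cV[R]_k} := [set colscale g u | u in runits R].

Definition multiplicity (R : finUnitRingType) (k n : nat) (G : 'M[R]_(k, n))
    (g : 'cV[R]_k) : nat :=
  #|[set j : 'I_n | cyclic_submod (col j G) == cyclic_submod g]|.

Definition no_zero_coordinate (R : finUnitRingType) (n : nat)
    (C : {set 'rV[R]_n}) : Prop :=
  forall j : 'I_n, exists2 c, c \in C & c 0 j != 0.

(* The condition does not depend on the choice of [k] and [G]. *)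
Definition modular_of_index (R : finUnitRingType) (n : nat)
    (C : {set 'rV[R]_n}) (r : rat) : Prop :=
  no_zero_coordinate C /\
  exists (k : nat) (G : 'M[R]_(k, n)),
    C = [set x *m G | x : 'rV[R]_k] /\
    (forall g : 'cV[R]_k, cyclic_submod g != [set 0] ->
       multiplicity G g = 0%N \/
       (multiplicity G g)%:R = r * #|unit_orbit g|%:R).

Definition modular (R : finUnitRingType) (n : nat) (C : {set 'rV[R]_n}) : Prop :=
  exists r : rat, modular_of_index C r.

Definition code0 (F : numClosedFieldType) (R : finUnitRingType) (n : nat)
    (chi : R -> F) (C : {set 'rV[R]_n}) : {set 'rV[R]_n} :=
  [set c in C | whomv chi c == 0].

Definition code_coset (F : numClosedFieldType) (R : finUnitRingType) (n : nat)
    (chi : R -> F) (C : {set 'rV[R]_n}) (c : 'rV[R]_n) : {set 'rV[R]_n} :=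
  [set c + d | d in code0 chi C].

Definition Gamma_vertices (F : numClosedFieldType) (R : finUnitRingType)
    (n : nat) (chi : R -> F) (C : {set 'rV[R]_n}) : {set {set 'rV[R]_n}} :=
  [set code_coset chi C c | c in C].

Definition Gamma_adj (F : numClosedFieldType) (R : finUnitRingType)
    (n : nat) (chi : R -> F) (C : {set 'rV[R]_n}) (w1 : F) :
    rel {set 'rV[R]_n} :=
  fun A B => [exists c in C, exists d in C,
    [&& A == code_coset chi C c, B == code_coset chi C d
      & whomv chi (c - d) == w1]].

(* A graph is given by a vertex set [V] inside a finite type [T], and a
   relation on [T] of which only the restriction to [V] matters. *)

Definition simple_graph (T : finType) (V : {set T}) (e : rel T) : Prop :=
  {in V &, symmetric e} /\ {in V, irreflexive e}.

Definition strongly_regular (T : finType) (V : {set T}) (e : rel T)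
    (N K l m : nat) : Prop :=
  [/\ simple_graph V e,
      #|V| = N,
      {in V, forall x, #|[set y in V | e x y]| = K},
      {in V &, forall x y, e x y ->
         #|[set z in V | e x z && e y z]| = l} &
      {in V &, forall x y, x != y -> ~~ e x y ->
         #|[set z in V | e x z && e y z]| = m}].

Definition compl_rel (T : finType) (e : rel T) : rel T :=
  fun x y => (x != y) && ~~ e x y.

Definition disjoint_equal_cliques (T : finType) (V : {set T}) (e : rel T) :
    Prop :=
  exists (P : {set {set T}}) (s : nat),
    [/\ partition P V,
        forall B : {set T}, B \in P -> #|B| = s &
        {in V &, forall x y, e x y = (x != y) && (pblock P x == pblock P y)}].

Definition trivial_graph (T : finType) (V : {set T}) (e : rel T) : Prop :=
  disjoint_equal_cliques V e \/ disjoint_equal_cliques V (compl_rel e).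

(* Main.v *)
(* Write [f = n - w_hom] and [g_1, ..., g_n] for the columns of the generator
   matrix.  Then [f (xG)] is the sum over [j] of the averages of [chi (x h)]
   over the orbit [h \in g_j R^x].  Modularity makes this a multiple of the
   Fourier transform of the indicator of the union of these orbits, so
   [f * f = rho f] on [C] for a constant [rho], and [f] has sum 0 since no [g_j]
   is 0.  As [f] is a combination of the indicators of [C_0], [C_1] and [C], the
   convolution square of the indicator of [C_1] is constant on [C_1] and on
   [C_2], which gives strong regularity with the stated parameters.  Triviality
   means [mu = 0] or [mu = K]; the first would force [w_2 = n] and hence
   [K < 0], and the second says [w_1 = n]. *)

Require Import Defs.
From HB Require Import structures.
From mathcomp Require Import all_boot all_order all_algebra.
From mathcomp Require Import ring.

Set Implicit Arguments.
Unset Strict Implicit.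
Unset Printing Implicit Defensive.

Import Order.TTheory GRing.Theory Num.Theory.
Local Open Scope ring_scope.

(** * Generating characters of a finite ring *)

(** Translation by an [a] in [C] with [psi a != 1] multiplies the sum by [psi a], so the sum
    vanishes. The form relative to a subset serves for codes as well as for the whole ring. *)
Lemma character_sum (F : numClosedFieldType) (V : finZmodType) (C : {set V})
    (psi : V -> F) :
  zmod_closed C -> {in C &, forall x y, psi (x + y) = psi x * psi y} ->
  psi 0 = 1 ->
  \sum_(x in C) psi x = if [forall x in C, psi x == 1] then #|C|%:R else 0.
Proof.
move=> [C0 CB] psiD psi0; case: ifPn => [/forall_inP h|].
  by rewrite (eq_bigr (fun=> 1)) ?sumr_const // => x /h/eqP.
have CN x : x \in C -> - x \in C by rewrite -sub0r; apply: CB.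
have CD x y : x \in C -> y \in C -> x + y \in C.
  by move=> Cx Cy; rewrite -[y]opprK; apply/CB/CN.
case/forall_inPn => a Ca psia; apply/eqP.
have: psi a * \sum_(x in C) psi x = \sum_(x in C) psi x.
  rewrite mulr_sumr [RHS](reindex_inj (addrI a)) /=.
  apply: eq_big => [x|x Cx]; last by rewrite psiD.
  by apply/idP/idP => [/(CD _ _ Ca)//|Cax]; rewrite -[x](addKr a) CD ?CN.
move/eqP; rewrite -subr_eq0 -{2}[\sum_(x in C) _]mul1r -mulrBl mulf_eq0.
by rewrite subr_eq0 (negPf psia).
Qed.

Lemma additive_character0 (F : numClosedFieldType) (R : finUnitRingType)
    (chi : R -> F) : additive_character chi -> chi 0 = 1.
Proof.
by case=> nz D; apply: (mulIf (nz 0)); rewrite -D addr0 mul1r.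
Qed.

Lemma additive_characterN (F : numClosedFieldType) (R : finUnitRingType)
    (chi : R -> F) x : additive_character chi -> chi (- x) = (chi x)^-1.
Proof.
move=> h; have [nz D] := h; apply: (mulfI (nz x)).
by rewrite -D subrr (additive_character0 h) mulfV.
Qed.

(** The product of [chi] over all of [R] is unchanged by translating the index by [x], which forces
    [chi x ^+ #|R| = 1]. *)
Lemma additive_character_norm (F : numClosedFieldType) (R : finUnitRingType)
    (chi : R -> F) x : additive_character chi -> `|chi x| = 1.
Proof.
move=> [nz D]; apply/eqP; rewrite -(@pexpr_eq1 _ _ #|R|) //; last first.
  by apply/card_gt0P; exists 0.
rewrite -normrX; suff -> : chi x ^+ #|R| = 1 by rewrite normr1.
have P0 : \prod_y chi y != 0 by apply/prodf_neq0 => y _; apply: nz.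
apply: (mulIf P0); rewrite mul1r [in RHS](reindex_inj (addrI x)) /=.
by rewrite (eq_bigr _ (fun y _ => D x y)) big_split /= prodr_const.
Qed.

Lemma additive_character_sum (F : numClosedFieldType) (R : finUnitRingType)
    (psi : R -> F) : additive_character psi ->
  \sum_x psi x = if [forall x, psi x == 1] then #|R|%:R else 0.
Proof.
move=> h; have := @character_sum F R [set: R] psi.
have -> : [forall x in [set: R], psi x == 1] = [forall x, psi x == 1].
  by apply: eq_forallb => x; rewrite inE.
rewrite cardsT => <-; first by apply: eq_bigl => x; rewrite inE.
- by split=> [|x y _ _]; rewrite inE.
- by move=> x y _ _; apply: h.2.
- exact: additive_character0.
Qed.

Lemma additive_character_mull (F : numClosedFieldType) (R : finUnitRingType)
    (chi : R -> F) a :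
  additive_character chi -> additive_character (fun x => chi (a * x)).
Proof. by case=> nz D; split=> [x|x y]; rewrite ?nz // mulrDr D. Qed.

Lemma additive_character_mulr (F : numClosedFieldType) (R : finUnitRingType)
    (chi : R -> F) a :
  additive_character chi -> additive_character (fun x => chi (x * a)).
Proof. by case=> nz D; split=> [x|x y]; rewrite ?nz // mulrDl D. Qed.

(** The kernel condition on principal left ideals [R x]; [right_nondegenerate] is its mirror image
    for [x R]. *)
Definition left_nondegenerate (F : numClosedFieldType) (R : finUnitRingType)
    (chi : R -> F) : Prop :=
  forall x, (forall a, chi (a * x) = 1) -> x = 0.

Definition right_nondegenerate (F : numClosedFieldType) (R : finUnitRingType)
    (chi : R -> F) : Prop :=
  forall x, (forall a, chi (x * a) = 1) -> x = 0.

Lemma card_ring_neq0 (F : numClosedFieldType) (R : finUnitRingType) :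
  #|R|%:R != 0 :> F.
Proof. by rewrite pnatr_eq0 -lt0n; apply/card_gt0P; exists 0. Qed.

(* Both sides count [\sum_x \sum_a chi (a * x)]: each sum equals [#|R|] times
   the number of annihilating elements on its side. *)
Lemma nondegenerate_count (F : numClosedFieldType) (R : finUnitRingType)
    (chi : R -> F) : additive_character chi ->
  #|[set x | [forall a, chi (a * x) == 1]]|
  = #|[set x | [forall a, chi (x * a) == 1]]|.
Proof.
move=> hchi; apply/eqP; rewrite -(eqr_nat F).
rewrite -(inj_eq (mulfI (card_ring_neq0 F R))).
have : \sum_x \sum_a chi (a * x) = \sum_x \sum_a chi (x * a).
  by rewrite exchange_big.
under eq_bigr => x _ do
  rewrite (additive_character_sum (additive_character_mulr x hchi)).
under [in X in _ = X -> _]eq_bigr => x _ do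
  rewrite (additive_character_sum (additive_character_mull x hchi)).
rewrite -[LHS]big_mkcond -[RHS]big_mkcond /= !sumr_const.
by rewrite -[LHS]mulr_natr -[RHS]mulr_natr !cardsE => ->.
Qed.

(** Each condition says that its set in [nondegenerate_count], which always contains 0, has at most
    one element. *)
Lemma left_right_nondegenerate (F : numClosedFieldType) (R : finUnitRingType)
    (chi : R -> F) : additive_character chi ->
  left_nondegenerate chi <-> right_nondegenerate chi.
Proof.
move=> hchi; have c0 := additive_character0 hchi.
have iffL : left_nondegenerate chi <->
    (#|[set x | [forall a, chi (a * x) == 1]%R]| <= 1)%N.
  split=> [h|/card_le1_eqP h x hx].
    apply/card_le1_eqP => x y; rewrite !inE => /forallP hx /forallP hy.
    have -> : x = 0 by apply: h => a; apply/eqP.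
    by have -> : y = 0 by apply: h => a; apply/eqP.
  by apply: h; rewrite inE; apply/forallP => a; rewrite ?hx // ?mulr0 ?c0.
have iffR : right_nondegenerate chi <->
    (#|[set x | [forall a, chi (x * a) == 1]%R]| <= 1)%N.
  split=> [h|/card_le1_eqP h x hx].
    apply/card_le1_eqP => x y; rewrite !inE => /forallP hx /forallP hy.
    have -> : x = 0 by apply: h => a; apply/eqP.
    by have -> : y = 0 by apply: h => a; apply/eqP.
  by apply: h; rewrite inE; apply/forallP => a; rewrite ?hx // ?mul0r ?c0.
by rewrite iffL iffR nondegenerate_count.
Qed.

Lemma generating_nondegenerate (F : numClosedFieldType) (R : finUnitRingType)
    (chi : R -> F) : generating_character chi ->
  left_nondegenerate chi /\ right_nondegenerate chi.
Proof.
move=> [hchi h]; case: h => h.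
- suff hL : left_nondegenerate chi.
    by split=> //; apply/left_right_nondegenerate.
  move=> x hx; have: [set a * x | a : R] = [set 0].
    apply: h.
      split; last first.
        move=> a _ /imsetP[b _ ->].
        by apply/imsetP; exists (a * b); rewrite ?mulrA.
      split=> [|_ _ /imsetP[a _ ->] /imsetP[b _ ->]].
        by apply/imsetP; exists 0; rewrite ?mul0r.
      by apply/imsetP; exists (a - b); rewrite ?mulrBl.
    by apply/subsetP => _ /imsetP[a _ ->]; rewrite inE hx.
  move/setP/(_ (1 * x)); rewrite inE mul1r => e; apply/eqP; rewrite -e.
  by apply/imsetP; exists 1; rewrite ?mul1r.
- suff hR : right_nondegenerate chi.
    by split=> //; apply/left_right_nondegenerate.
  move=> x hx; have: [set x * a | a : R] = [set 0].
    apply: h.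
      split; last first.
        move=> a _ /imsetP[b _ ->].
        by apply/imsetP; exists (b * a); rewrite ?mulrA.
      split=> [|_ _ /imsetP[a _ ->] /imsetP[b _ ->]].
        by apply/imsetP; exists 0; rewrite ?mulr0.
      by apply/imsetP; exists (a - b); rewrite ?mulrBr.
    by apply/subsetP => _ /imsetP[a _ ->]; rewrite inE hx.
  move/setP/(_ (x * 1)); rewrite inE mulr1 => e; apply/eqP; rewrite -e.
  by apply/imsetP; exists 1; rewrite ?mulr1.
Qed.

(* If [psi] were none of the [chi (a * _)], it would be orthogonal to all of
   them; but the conjugates of these sum to [#|R|] times the indicator of 0. *)
Lemma additive_character_rep (F : numClosedFieldType) (R : finUnitRingType)
    (chi psi : R -> F) :
  additive_character chi -> left_nondegenerate chi -> additive_character psi ->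
  exists a, forall x, psi x = chi (a * x).
Proof.
move=> hchi hL hpsi.
have [/existsP[a /forallP ha]|/existsPn hn] :=
  boolP [exists a, [forall x, psi x == chi (a * x)]].
  by exists a => x; apply/eqP.
have z : \sum_a \sum_x psi x * chi (- (a * x)) = 0.
  apply: big1 => a _; rewrite additive_character_sum; last first.
    split=> [x|x y]; first by rewrite mulf_neq0 ?hpsi.1 ?hchi.1.
    by rewrite mulrDr opprD hpsi.2 hchi.2 mulrACA.
  case: ifP => // /forallP h; case/negP: (hn a); apply/forallP => x.
  have /eqP := h x; rewrite additive_characterN // => /(canRL (mulfVK _)) -> //.
    by rewrite mul1r.
  exact: hchi.1.
move: z; rewrite exchange_big (bigD1 0) //= [X in _ + X]big1 => [|x x0].
  rewrite addr0 (eq_bigr (fun=> 1)) => [|a _]; last first.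
    by rewrite mulr0 oppr0 !additive_character0 // mulr1.
  by rewrite sumr_const => /eqP; rewrite (negPf (card_ring_neq0 F R)).
rewrite -mulr_sumr; under eq_bigr => a _ do rewrite -mulNr.
rewrite (reindex_inj oppr_inj) /=; under eq_bigr => a _ do rewrite opprK.
rewrite (additive_character_sum (additive_character_mulr x hchi)).
case: ifP => [/forallP h|_]; last by rewrite mulr0.
by case/eqP: x0; apply: hL => a; apply/eqP.
Qed.

(** Left multiplication by [y] is injective, hence onto by finiteness; this gives [y] a right
    inverse, which must be [x]. *)
Lemma fin_mulr1_unit (R : finUnitRingType) (x y : R) :
  x * y = 1 -> (x \is a GRing.unit) && (y \is a GRing.unit).
Proof.
move=> xy; have inj : injective ( *%R y).
  by move=> a b /(congr1 ( *%R x)); rewrite !mulrA xy !mul1r.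
have /codomP[w /esym yw] := injF_onto inj 1.
have yx : y * x = 1.
  by have -> : x = w by rewrite -[w]mul1r -xy -mulrA yw mulr1.
by apply/andP; split; apply/unitrP; [exists y|exists x].
Qed.

(* [chi (x * u) = chi (s u * x)] defines an injective multiplicative map [s]
   (the Nakayama automorphism), which therefore permutes the units. *)
Lemma sum_units_comm (F : numClosedFieldType) (R : finUnitRingType)
    (chi : R -> F) (x : R) : generating_character chi ->
  \sum_(u in runits R) chi (u * x) = \sum_(u in runits R) chi (x * u).
Proof.
move=> h; have [hL hR] := generating_nondegenerate h; have [hchi _] := h.
have /fin_all_exists[s hs] :
    forall b, exists a, forall x, chi (x * b) = chi (a * x).
  move=> b.
  by apply: additive_character_rep; rewrite //; apply: additive_character_mulr.
(* Right nondegeneracy determines [a] from [chi (a * _)], which makes [s] multiplicative; left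
   nondegeneracy makes [s] injective. *)
have eqR a b : (forall x, chi (a * x) = chi (b * x)) -> a = b.
  move=> e; apply/eqP; rewrite -subr_eq0; apply/eqP/hR => y.
  by rewrite mulrBl hchi.2 additive_characterN // e mulfV ?hchi.1.
have s_inj : injective s.
  move=> a b e; apply/eqP; rewrite -subr_eq0; apply/eqP/hL => y.
  by rewrite mulrBr hchi.2 additive_characterN // (hs a) (hs b) e mulfV ?hchi.1.
have s1 : s 1 = 1 by apply: eqR => y; rewrite -(hs 1) mulr1 mul1r.
have sM a b : s (a * b) = s a * s b.
  by apply: eqR => y; rewrite -(hs (a * b)) mulrA (hs b) mulrA (hs a) mulrA.
have sU : s @: runits R = runits R.
  apply/eqP; rewrite eqEcard card_imset // leqnn andbT.
  apply/subsetP => _ /imsetP[u Uu ->]; rewrite !inE in Uu *.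
  by have /fin_mulr1_unit/andP[] : s u * s u^-1 = 1 by rewrite -sM divrr.
rewrite -[in LHS]sU big_imset /=; last exact: in2W.
by apply: eq_bigr => u _; rewrite (hs u).
Qed.

(** * Cyclic right modules and unit orbits *)

Lemma colscaleM (R : finUnitRingType) (k : nat) (g : 'cV[R]_k) (a b : R) :
  colscale g (a * b) = colscale (colscale g a) b.
Proof. by apply/colP => i; rewrite !mxE mulrA. Qed.

Lemma colscale1 (R : finUnitRingType) (k : nat) (g : 'cV[R]_k) :
  colscale g 1 = g.
Proof. by apply/colP => i; rewrite !mxE mulr1. Qed.

Lemma colscaleD (R : finUnitRingType) (k : nat) (g : 'cV[R]_k) (a b : R) :
  colscale g (a + b) = colscale g a + colscale g b.
Proof. by apply/colP => i; rewrite !mxE mulrDr. Qed.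

Lemma colscaleB (R : finUnitRingType) (k : nat) (g : 'cV[R]_k) (a b : R) :
  colscale g (a - b) = colscale g a - colscale g b.
Proof. by apply/colP => i; rewrite !mxE mulrBr. Qed.

Lemma cyclic_submod_id (R : finUnitRingType) (k : nat) (g : 'cV[R]_k) :
  g \in cyclic_submod g.
Proof. by apply/imsetP; exists 1; rewrite ?colscale1. Qed.

Definition right_principal (R : finUnitRingType) (y : R) : {set R} :=
  [set y * a | a : R].

Lemma right_principal_sub (R : finUnitRingType) (y z : R) :
  (right_principal y \subset right_principal z) = (y \in right_principal z).
Proof.
apply/subsetP/idP => [|/imsetP[a _ ->] _ /imsetP[b _ ->]].
  by apply; apply/imsetP; exists 1; rewrite ?mulr1.
by apply/imsetP; exists (a * b); rewrite ?mulrA.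
Qed.

(* The solutions [y] of [g y = h] (resp. [g y = g]) inside a right ideal [zR]
   form a coset of the same subgroup when [gR = hR]; the two sets are both
   empty or both nonempty, as [g] and [h] are multiples of each other. *)
Lemma card_solutions_in_ideal (R : finUnitRingType) (k : nat)
    (g h : 'cV[R]_k) (z : R) : cyclic_submod g = cyclic_submod h ->
  #|[set y in right_principal z | colscale g y == h]|
  = #|[set y in right_principal z | colscale g y == g]|.
Proof.
move=> gh.
have [b _ hb] : exists2 b, b \in R & h = colscale g b.
  by have /imsetP[b _ ->] : h \in cyclic_submod g;
    [rewrite gh cyclic_submod_id|exists b].
have [a _ ga] : exists2 a, a \in R & g = colscale h a.
  by have /imsetP[a _ ->] : g \in cyclic_submod h;
    [rewrite -gh cyclic_submod_id|exists a].
have zM y c : y \in right_principal z -> y * c \in right_principal z.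
  by case/imsetP=> d _ ->; apply/imsetP; exists (d * c); rewrite ?mulrA.
have zD y c : y \in right_principal z -> c \in right_principal z ->
    y + c \in right_principal z.
  case/imsetP=> d _ -> /imsetP[e _ ->].
  by apply/imsetP; exists (d + e); rewrite ?mulrDr.
have zN y : y \in right_principal z -> - y \in right_principal z.
  by case/imsetP=> d _ ->; apply/imsetP; exists (- d); rewrite ?mulrN.
have [/existsP[y0 /andP[zy0 /eqP gy0]]|/existsPn no] :=
  boolP [exists y, (y \in right_principal z) && (colscale g y == h)].
  have gy1 : colscale g (y0 * a) = g by rewrite colscaleM gy0 -ga.
  (* Since [g t = g - h], adding [t] carries the solutions of [g y = h] in [zR] onto those of
     [g y = g]. *)
  have zy1 := zM _ a zy0; pose t := y0 * a - y0.
  have zt : t \in right_principal z by rewrite zD ?zN.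
  have gt : colscale g t = g - h by rewrite colscaleB gy1 gy0.
  rewrite -(card_imset _ (addIr t)); apply: eq_card => y; rewrite inE.
  apply/imsetP/andP => [[x]|[zy /eqP gy]].
    rewrite inE => /andP[zx /eqP gx] ->.
    by rewrite zD // colscaleD gx gt addrC subrK eqxx.
  exists (y - t); rewrite ?subrK // inE zD ?zN //=.
  by rewrite colscaleB gy gt opprB addrC subrK.
rewrite !eq_card0 // => y; rewrite inE; apply/negP => /andP[zy /eqP gy].
  by case/negP: (no (y * b)); rewrite zM // colscaleM gy hb eqxx.
by case/negP: (no y); rewrite zy gy eqxx.
Qed.

(* Induction on [D], summing over the right ideals inside it, shows that
   [g y = h] and [g y = g] have equally many solutions [y] with [yR = D]; for
   [D = R], the second equation has the solution [1]. *)
Lemma cyclic_submod_unit (R : finUnitRingType) (k : nat) (g h : 'cV[R]_k) :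
  cyclic_submod g = cyclic_submod h ->
  exists2 u, u \in runits R & h = colscale g u.
Proof.
move=> gh.
pose N x D := #|[set y | (colscale g y == x) && (right_principal y == D)]|.
have NE D : N h D = N g D.
  have [m] := ubnP #|D|; elim: m D => // m IH D; rewrite ltnS => Dm.
  have [/existsP[z /eqP Dz]|/existsPn no] :=
    boolP [exists z : R, right_principal z == D]; last first.
    by rewrite /N !eq_card0 // => y; rewrite inE (negPf (no y)) andbF.
  have split_sum x : #|[set y in right_principal z | colscale g y == x]|
      = (N x D + \sum_(E : {set R} | (E \subset D) && (E != D)) N x E)%N.
    rewrite -(bigD1 D (F := N x)) //= -sum1_card.
    rewrite (partition_big (@right_principal R) (fun E => E \subset D)) /=.
      apply: eq_bigr => E ED; rewrite /N -sum1_card; apply: eq_bigl => y.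
      rewrite !inE -right_principal_sub Dz.
      by have [->|] := eqVneq (right_principal y) E; rewrite ?andbF // ED.
    by move=> y; rewrite inE -right_principal_sub Dz => /andP[].
  have := card_solutions_in_ideal z gh; rewrite !split_sum.
  rewrite (eq_bigr (N g)) => [/addIn//|E /andP[ED EnD]].
  apply: IH; apply: leq_trans Dm; apply: proper_card.
  by rewrite properEneq EnD.
have: N h (right_principal 1) != 0%N.
  rewrite NE -lt0n; apply/card_gt0P; exists 1.
  by rewrite inE colscale1 !eqxx.
rewrite -lt0n => /card_gt0P[u]; rewrite inE => /andP[/eqP <- /eqP u1].
exists u => //; rewrite inE.
(* From [uR = R] comes a right inverse of [u], and one-sided inverses are two-sided in a finite
   ring. *)
have : 1 \in right_principal u.
  by rewrite u1; apply/imsetP; exists 1; rewrite ?mulr1.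
by case/imsetP=> v _ /esym/fin_mulr1_unit/andP[].
Qed.

Lemma runitsM (R : finUnitRingType) (u v : R) :
  u \in runits R -> v \in runits R -> u * v \in runits R.
Proof. by rewrite !inE => Uu Uv; rewrite unitrMl. Qed.

Lemma runitsV (R : finUnitRingType) (u : R) :
  u \in runits R -> u^-1 \in runits R.
Proof. by rewrite !inE unitrV. Qed.

Lemma cyclic_submod_scale (R : finUnitRingType) (k : nat) (g : 'cV[R]_k) u :
  u \in runits R -> cyclic_submod (colscale g u) = cyclic_submod g.
Proof.
rewrite inE => Uu; apply/setP => x; apply/imsetP/imsetP => -[a _ ->].
  by exists (u * a); rewrite ?colscaleM.
by exists (u^-1 * a); rewrite // -colscaleM mulrA divrr // mul1r.
Qed.

(* Orbit-stabilizer for the right action of the units. *)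
Lemma card_unit_orbit (R : finUnitRingType) (k : nat) (g h : 'cV[R]_k) :
  h \in unit_orbit g ->
  (#|[set u in runits R | colscale g u == h]| * #|unit_orbit g|
   = #|runits R|)%N.
Proof.
case/imsetP=> w Uw ->; rewrite mulnC -sum_nat_const -[RHS]sum1_card.
rewrite [RHS](partition_big (colscale g) (mem (unit_orbit g))) /=; last first.
  by move=> u Uu; apply/imsetP; exists u.
apply: eq_bigr => _ /imsetP[v Uv ->]; rewrite sum1dep_card.
have [Uw' Uv'] : w \is a GRing.unit /\ v \is a GRing.unit.
  by rewrite !inE in Uw Uv.
have Ut : w^-1 * v \is a GRing.unit by rewrite unitrMl ?unitrV.
(* Right multiplication by [w^-1 * v] carries the fibre over [g w] onto the fibre over [g v], so all
   fibres have the same size. *)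
rewrite -[LHS](card_imset _ (mulIr Ut)); apply: eq_card => u; rewrite [RHS]inE.
apply/imsetP/andP => [[x]|[Uu /eqP gu]].
  rewrite inE => /andP[Ux /eqP gx] ->; split; first by rewrite !runitsM ?runitsV.
  by rewrite colscaleM gx -colscaleM mulrA divrr // mul1r.
exists (u * (w^-1 * v)^-1); last by rewrite divrK.
rewrite inE !runitsM ?runitsV ?runitsM ?runitsV //=.
by rewrite colscaleM gu -colscaleM invrM ?unitrV // invrK mulrA divrr // mul1r.
Qed.

Lemma unit_orbit_cyclic (R : finUnitRingType) (k : nat) (g h : 'cV[R]_k) :
  cyclic_submod g = cyclic_submod h -> unit_orbit g = unit_orbit h.
Proof.
have sub g1 g2 : cyclic_submod g1 = cyclic_submod g2 ->
    unit_orbit g1 \subset unit_orbit g2.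
  case/esym/cyclic_submod_unit=> u Uu ->.
  apply/subsetP => _ /imsetP[v Uv ->].
  by apply/imsetP; exists (u * v); rewrite ?runitsM ?colscaleM.
by move=> e; apply/eqP; rewrite eqEsubset !sub.
Qed.

(** A column contributes only if it generates the same cyclic module as column [j]; it then has the
    same unit orbit, and its contribution is the order of a stabilizer. *)
Lemma card_proportional_columns (R : finUnitRingType) (k n : nat)
    (G : 'M[R]_(k, n)) (j : 'I_n) (v : R) : v \in runits R ->
  ((\sum_(i < n) #|[set u in runits R | colscale (col i G) u
                      == colscale (col j G) v]|)
     * #|unit_orbit (col j G)| = multiplicity G (col j G) * #|runits R|)%N.
Proof.
move=> Uv; rewrite /multiplicity big_distrl -[RHS]sum_nat_const /=.
rewrite [RHS]big_mkcond /=; apply: eq_bigr => i _; rewrite inE.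
case: eqP => [e|ne].
  rewrite -(unit_orbit_cyclic e); apply: card_unit_orbit.
  by rewrite (unit_orbit_cyclic e); apply/imsetP; exists v.
rewrite eq_card0 ?mul0n // => u; rewrite !inE; apply/negP => /andP[Uu /eqP e].
by case: ne; rewrite -(@cyclic_submod_scale _ _ _ u) ?inE // e cyclic_submod_scale.
Qed.

(** * The homogeneous weight and its autocorrelation *)

(** Units act on the right here, unlike in [whom], to match the orbits [g_j R^x] of the columns of a
    generator matrix; [sum_units_comm] reconciles the two sides. *)
Definition corr (F : numClosedFieldType) (R : finUnitRingType) (n : nat)
    (chi : R -> F) (c : 'rV[R]_n) : F :=
  \sum_(j < n) \sum_(u in runits R) chi (c 0 j * u).

Lemma card_runits_neq0 (F : numClosedFieldType) (R : finUnitRingType) :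
  #|runits R|%:R != 0 :> F.
Proof.
by rewrite pnatr_eq0 -lt0n; apply/card_gt0P; exists 1; rewrite inE unitr1.
Qed.

Lemma whomv_corr (F : numClosedFieldType) (R : finUnitRingType) (n : nat)
    (chi : R -> F) (c : 'rV[R]_n) : generating_character chi ->
  n%:R - whomv chi c = (#|runits R|%:R)^-1 * corr chi c.
Proof.
move=> h; rewrite /whomv /whom sumrB sumr_const card_ord opprB addrC subrK.
by rewrite -mulr_sumr; congr (_ * _); apply: eq_bigr => j _; rewrite sum_units_comm.
Qed.

Lemma corrN (F : numClosedFieldType) (R : finUnitRingType) (n : nat)
    (chi : R -> F) (c : 'rV[R]_n) : corr chi (- c) = corr chi c.
Proof.
apply: eq_bigr => j _; rewrite (reindex_inj oppr_inj) /=.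
by apply: eq_big => [u|u _]; rewrite ?inE ?unitrN // mxE mulrNN.
Qed.

Lemma whomvN (F : numClosedFieldType) (R : finUnitRingType) (n : nat)
    (chi : R -> F) (c : 'rV[R]_n) : generating_character chi ->
  whomv chi (- c) = whomv chi c.
Proof.
by move=> h; apply/oppr_inj/(addrI n%:R); rewrite !whomv_corr // corrN.
Qed.

(* Equality case of the triangle inequality. *)
Lemma whomv_eq0 (F : numClosedFieldType) (R : finUnitRingType) (n : nat)
    (chi : R -> F) (c : 'rV[R]_n) : generating_character chi ->
  whomv chi c = 0 <->
  (forall j u, u \in runits R -> chi (c 0 j * u) = 1).
Proof.
move=> h; have U0 := card_runits_neq0 F R.
have whomvE : whomv chi c = n%:R - (#|runits R|%:R)^-1 * corr chi c.
  by rewrite -whomv_corr // opprB addrC subrK.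
have sum1E : \sum_(p : 'I_n * R | p.2 \in runits R) 1 = n%:R * #|runits R|%:R :> F.
  rewrite -(pair_big predT (mem (runits R)) (fun _ _ => 1)) /=.
  by rewrite !sumr_const card_ord [RHS]mulr_natl.
have corrE : corr chi c = \sum_(p : 'I_n * R | p.2 \in runits R)
    chi (c 0 p.1 * p.2).
  by rewrite -(pair_big predT (mem (runits R)) (fun j u => chi (c 0 j * u))).
split=> [/eqP|h1].
  rewrite whomvE subr_eq0 eq_sym => /eqP/(canRL (mulVKf U0)).
  rewrite mulrC corrE -sum1E => e j u Uu.
  apply: (normC_sum_upper _ e (i := (j, u))) => // p _ /=.
  by rewrite additive_character_norm //; case: h.
rewrite whomvE corrE (eq_bigr (fun=> 1)) => [|p Up]; last exact: h1.
by rewrite sum1E mulrCA mulVf // mulr1 subrr.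
Qed.

(** By [whomv_eq0], every character value contributed by [d] is 1, so no term of [corr] changes. *)
Lemma whomvD0 (F : numClosedFieldType) (R : finUnitRingType) (n : nat)
    (chi : R -> F) (c d : 'rV[R]_n) : generating_character chi ->
  whomv chi d = 0 -> whomv chi (c + d) = whomv chi c.
Proof.
move=> h /(whomv_eq0 _ h) d1; apply/oppr_inj/(addrI n%:R); rewrite !whomv_corr //.
congr (_ * _); apply: eq_bigr => j _; apply: eq_bigr => u Uu.
by case: h => -[_ D] _; rewrite mxE mulrDl D d1 // mulr1.
Qed.

(** For [c = xG] the argument of [chi] is [x (g_i u - g_j v)]. Taking for [x] the multiples of unit
    vectors, left nondegeneracy kills each entry of the difference. This decides which terms survive
    summation over the code. *)
Lemma eq_colscale_code (F : numClosedFieldType) (R : finUnitRingType)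
    (k n : nat) (G : 'M[R]_(k, n)) (chi : R -> F) (i j : 'I_n) (u v : R) :
  generating_character chi ->
  [forall c in [set x *m G | x : 'rV[R]_k], chi (c 0 i * u - c 0 j * v) == 1]
  = (colscale (col i G) u == colscale (col j G) v).
Proof.
move=> h; have [hL _] := generating_nondegenerate h; have [hchi _] := h.
apply/forall_inP/eqP => [h1|e _ /imsetP[x _ ->]].
  apply/colP => l; rewrite !mxE; apply/eqP; rewrite -subr_eq0; apply/eqP/hL => a.
  have /h1/eqP : a *: row l G \in [set x *m G | x : 'rV[R]_k].
    by apply/imsetP; exists (a *: delta_mx 0 l); rewrite // -scalemxAl -rowE.
  by rewrite !mxE -!mulrA -mulrBr.
have colE l w : (x *m G) 0 l * w = (x *m colscale (col l G) w) 0 0.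
  by rewrite !mxE mulr_suml; apply: eq_bigr => m _; rewrite !mxE mulrA.
by rewrite !colE e subrr additive_character0.
Qed.

Lemma linear_code_zmod (R : finUnitRingType) (n : nat) (C : {set 'rV[R]_n}) :
  linear_code C -> zmod_closed C.
Proof. by move=> h; split; [case: h | exact: (GRing.submod_closedB h).2]. Qed.

(** Each character [c |-> chi (c_j u)] is nontrivial on [C]: otherwise left nondegeneracy, applied
    to the multiples of a word with [c_j != 0], would give [c_j u = 0]. *)
Lemma corr_sum (F : numClosedFieldType) (R : finUnitRingType) (n : nat)
    (chi : R -> F) (C : {set 'rV[R]_n}) : generating_character chi ->
  linear_code C -> no_zero_coordinate C -> \sum_(c in C) corr chi c = 0.
Proof.
move=> h Clin nz; have [hL _] := generating_nondegenerate h; have [hchi _] := h.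
rewrite exchange_big /= big1 // => j _; rewrite exchange_big /= big1 // => u Uu.
rewrite (character_sum (linear_code_zmod Clin)) //; last 2 first.
- by move=> x y _ _; rewrite mxE mulrDl hchi.2.
- by rewrite mxE mul0r additive_character0.
case: ifP => // /forall_inP h1; have [c Cc] := nz j; case/eqP.
have /(canRL (mulrK _)) -> : c 0 j * u = 0; rewrite ?mul0r //.
  apply: hL => a; rewrite mulrA.
  have /h1/eqP : a *: c \in C by rewrite -[_ *: _]addr0 Clin.2 ?Clin.1.
  by rewrite mxE.
by rewrite inE in Uu.
Qed.

(** The product of [chi (d_i u)] and [chi ((c - d)_j v)] is [chi (c_j v) chi (d_i u - d_j v)].
    Summing over [d] leaves [#|C|] exactly when [g_i u = g_j v], and by modularity the number of
    such pairs [(i, u)] is [r #|R^x|] for every [j] and [v]. *)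
Lemma corr_conv (F : numClosedFieldType) (R : finUnitRingType) (n : nat)
    (chi : R -> F) (C : {set 'rV[R]_n}) (r : rat) : generating_character chi ->
  linear_code C -> modular_of_index C r -> forall c, c \in C ->
  \sum_(d in C) corr chi d * corr chi (c - d)
  = #|C|%:R * ratr r * #|runits R|%:R * corr chi c.
Proof.
move=> h Clin [nz [k [G [CE hG]]]] c Cc; have [hchi _] := h.
have count j v : v \in runits R ->
    \sum_(i < n) \sum_(u in runits R)
      (colscale (col i G) u == colscale (col j G) v)%:R
    = ratr r * #|runits R|%:R :> F.
  move=> Uv; have O0 : #|unit_orbit (col j G)|%:R != 0 :> F.
    rewrite pnatr_eq0 -lt0n; apply/card_gt0P; exists (colscale (col j G) v).
    by apply/imsetP; exists v.
  (* A zero column of [G] would make coordinate [j] vanish on the whole code. *)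
  have g0 : cyclic_submod (col j G) != [set 0].
    apply/eqP => e; have := cyclic_submod_id (col j G); rewrite e inE => /eqP g0.
    have [d] := nz j; rewrite CE => /imsetP[x _ ->] /eqP; apply.
    rewrite !mxE big1 // => l _; move/colP/(_ l): g0; rewrite !mxE => ->.
    by rewrite mulr0.
  have /(congr1 (fun m : nat => m%:R : F)) := card_proportional_columns G j Uv.
  rewrite !natrM natr_sum => e; apply: (mulIf O0).
  rewrite -[RHS]mulrAC.
  have -> : ratr r * #|unit_orbit (col j G)|%:R = (multiplicity G (col j G))%:R :> F.
    (* Multiplicity 0 is impossible, since column [j] itself is counted. *)
    case: (hG _ g0) => [m0|/(congr1 (fun q => ratr q : F))].
      suff: (0 < multiplicity G (col j G))%N by rewrite m0.
      by apply/card_gt0P; exists j; rewrite inE.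
    by rewrite rmorphM /= !ratr_nat => <-.
  rewrite -e; congr (_ * _); apply: eq_bigr => i _.
  by rewrite -natr_sum -sum1dep_card big_mkcondr.
transitivity (\sum_(j < n) \sum_(v in runits R) chi (c 0 j * v) *
   \sum_(i < n) \sum_(u in runits R)
      \sum_(d in C) chi (d 0 i * u - d 0 j * v)); last first.
  rewrite /corr mulr_sumr; apply: eq_bigr => j _.
  rewrite mulr_sumr; apply: eq_bigr => v Uv; rewrite mulrC; congr (_ * _).
  rewrite -mulrA -(count j v Uv) mulr_sumr; apply: eq_bigr => i _.
  rewrite mulr_sumr; apply: eq_bigr => u Uu.
  rewrite (character_sum (linear_code_zmod Clin)); last 2 first.
  - by move=> x y _ _; rewrite !mxE !mulrDl opprD addrACA hchi.2.
  - by rewrite !mxE !mul0r subrr additive_character0.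
  rewrite [in X in if X then _ else _]CE eq_colscale_code //.
  by case: eqP; rewrite ?mulr1 ?mulr0.
have e1 d : corr chi d * corr chi (c - d) =
    \sum_(j < n) \sum_(v in runits R) \sum_(i < n) \sum_(u in runits R)
       chi (c 0 j * v) * chi (d 0 i * u - d 0 j * v).
  rewrite mulrC mulr_suml; apply: eq_bigr => j _.
  rewrite mulr_suml; apply: eq_bigr => v _.
  rewrite mulr_sumr; apply: eq_bigr => i _.
  rewrite mulr_sumr; apply: eq_bigr => u _.
  by rewrite -!hchi.2 !mxE mulrBl addrAC addrA.
rewrite (eq_bigr _ (fun d _ => e1 d)) exchange_big; apply: eq_bigr => j _ /=.
rewrite exchange_big; apply: eq_bigr => v _ /=; rewrite mulr_sumr.
rewrite exchange_big; apply: eq_bigr => i _ /=; rewrite mulr_sumr.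
by rewrite exchange_big; apply: eq_bigr => u _ /=; rewrite mulr_sumr.
Qed.

(* With [f = n - w], hypothesis [f * f = rho f] and [sum f = 0] determine the
   convolution of [f] with the indicator [A] of the words of weight [w1], since
   [f = w2 D + (w2 - w1) A + (n - w2)] for the indicator [D] of weight 0. *)
Lemma two_weight_convolution (F : numClosedFieldType) (V : finZmodType)
    (C : {set V}) (w : V -> F) (n w1 w2 rho : F) :
  zmod_closed C -> n != 0 -> w1 != 0 -> w2 != 0 -> w1 != w2 -> w 0 = 0 ->
  {in C, forall c, w (- c) = w c} ->
  {in C &, forall c d, w d = 0 -> w (c + d) = w c} ->
  {in C, forall c, w c = 0 \/ w c = w1 \/ w c = w2} ->
  \sum_(d in C) (n - w d) = 0 ->
  {in C, forall c, \sum_(d in C) (n - w d) * (n - w (c - d)) = rho * (n - w c)} ->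
  let M : F := #|[set d in C | w d == 0]|%:R in
  let K : F := #|[set d in C | w d == w1]|%:R in
  let S c : F := #|[set d in C | (w d == w1) && (w (c - d) == w1)]|%:R in
  (w2 - w1) * K = (w2 - n) * #|C|%:R - w2 * M /\
  {in C, forall c, w2 * (w c == w1)%:R * M + (w2 - w1) * S c + (n - w2) * K
            = K * (n - w1) / n * (n - w c)}.
Proof.
move=> [C0 CB] n0 w10 w20 w12 w00 wN wD wC sumf convf M K S.
have CN c : c \in C -> - c \in C by rewrite -sub0r; apply: CB.
have fE c : c \in C ->
    n - w c = w2 * (w c == 0)%:R + (w2 - w1) * (w c == w1)%:R + (n - w2).
  case/wC => [->|[->|->]]; rewrite ?eqxx.
  - by rewrite (eq_sym 0) (negPf w10) /=; ring.
  - by rewrite (negPf w10) /=; ring.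
  - by rewrite (negPf w20) (eq_sym w2) (negPf w12) /=; ring.
have sum_ind (P : pred V) : \sum_(d in C) (P d)%:R = #|[set d in C | P d]|%:R :> F.
  by rewrite -natr_sum -sum1dep_card big_mkcondr.
have reidx c (g : V -> F) : c \in C ->
    \sum_(d in C) g (c - d) = \sum_(d in C) g d.
  move=> Cc; rewrite [RHS](reindex_inj (inv_inj (subKr c))) /=.
  apply: eq_bigl => d; apply/idP/idP => [Cd|Cd]; first exact: CB.
  by rewrite -[d](subKr c) CB.
have sumfB c : c \in C -> \sum_(d in C) (n - w (c - d)) = 0.
  by move=> Cc; rewrite (reidx c (fun d => n - w d)).
(* Translation by an element of weight 0 preserves [w], so convolution with the indicator of weight
   0 is multiplication by [M]. *)
have sumDf c : c \in C ->
    \sum_(d in C) (w d == 0)%:R * (n - w (c - d)) = M * (n - w c).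
  move=> Cc; rewrite /M -sum_ind mulr_suml; apply: eq_bigr => d Cd.
  case: eqP => [d0|]; rewrite ?mul0r // !mul1r wD ?CN //.
  by rewrite wN.
pose Q c := \sum_(d in C) (w d == w1)%:R * (n - w (c - d)).
have QE c : c \in C -> (w2 - w1) * Q c = (rho - w2 * M) * (n - w c).
  move=> Cc; rewrite [RHS]mulrBl -convf //.
  rewrite (eq_bigr (fun d => w2 * ((w d == 0)%:R * (n - w (c - d)))
     + (w2 - w1) * ((w d == w1)%:R * (n - w (c - d)))
     + (n - w2) * (n - w (c - d)))) => [|d Cd]; last by rewrite {1}fE //; ring.
  by rewrite !big_split /= -!mulr_sumr sumfB // sumDf // /Q; ring.
(* The value at 0, where [n - w 0 = n], expresses [rho - w2 * M] through [K]; thus [rho] disappears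
   from the conclusion. *)
have Q0 : Q 0 = K * (n - w1).
  rewrite /K -sum_ind mulr_suml; apply: eq_bigr => d Cd.
  by rewrite sub0r wN //; case: eqP => [->|]; rewrite ?mul0r.
have w21 : w2 - w1 != 0 by rewrite subr_eq0 eq_sym.
have Qf c : c \in C -> Q c = K * (n - w1) / n * (n - w c).
  move=> Cc; apply: (mulfI w21); rewrite QE //.
  have -> : rho - w2 * M = (w2 - w1) * (K * (n - w1) / n).
    by apply: (mulIf n0); have := QE _ C0; rewrite Q0 w00 subr0 => <-; field.
  by ring.
split.
  move: sumf; rewrite (eq_bigr _ fE) !big_split /= -!mulr_sumr !sum_ind !sumr_const.
  rewrite -(mulr_natr n) -(mulr_natr (- w2)) -/M -/K => e.
  by apply/eqP; rewrite -subr_eq0 -[X in _ == X]e; apply/eqP; ring.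
move=> c Cc; rewrite -Qf // /Q.
(* Expanding the remaining factor by [fE] turns [Q c] into convolutions of the indicator of weight
   [w1] with indicators. *)
rewrite [RHS](eq_bigr (fun d => w2 * ((w d == w1)%:R * (w (c - d) == 0)%:R)
   + (w2 - w1) * ((w d == w1) && (w (c - d) == w1))%:R
   + (n - w2) * (w d == w1)%:R)) => [|d Cd]; last first.
  by rewrite fE ?CB // -mulnb natrM; ring.
rewrite !big_split /= -!mulr_sumr !sum_ind -/K -/(S c); congr (_ + _ + _).
rewrite -mulrA; congr (_ * _).
(* After the reflection [d |-> c - d], only [d] of weight 0 contribute, and for these
   [w (c - d) = w c]. *)
rewrite -(reidx c) // mulrC /M -sum_ind mulr_suml; apply: eq_bigr => d Cd.
rewrite subKr mulrC; case: (w d =P 0) => [d0|]; rewrite ?mulr0 // !mulr1.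
by rewrite wD ?CN ?wN.
Qed.

(** * The graph of a code *)

(** In a disjoint union of cliques nonadjacent vertices have no common neighbour, which [m != 0]
    excludes. The complement is such a union exactly when nonadjacent vertices share all their
    neighbours, that is, when [m = K]; the given nonadjacent pair ties [m] to the graph. *)
Lemma strongly_regular_trivial (T : finType) (V : {set T}) (e : rel T)
    (N K l m : nat) : strongly_regular V e N K l m ->
  (exists x y, [/\ x \in V, y \in V, x != y & ~~ e x y]) -> m != 0%N ->
  trivial_graph V e <-> m = K.
Proof.
case=> -[sym irr] cardV deg _ hm [x0 [y0 [Vx0 Vy0 xy0 nxy0]]] m0.
split=> [[]|mK].
- case=> P [s [_ _ eP]]; case/eqP: m0; rewrite -(hm x0 y0) //.
  apply/eqP; rewrite cards_eq0; apply/eqP/setP => z; rewrite !inE.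
  apply/negP => /and3P[Vz]; rewrite !eP // => /andP[_ /eqP xz] /andP[_ /eqP yz].
  by move: nxy0; rewrite eP // xy0 xz yz eqxx.
- case=> P [s [_ _ eP]]; rewrite -(hm x0 y0) // -(deg x0) //.
  have eE x z : x \in V -> z \in V -> e x z = (pblock P x != pblock P z).
    move=> Vx Vz; have := eP x z Vx Vz; rewrite /compl_rel.
    by case: (eqVneq x z) => [->|_] /=; [rewrite irr ?eqxx|move=> <-; rewrite negbK].
  apply: eq_card => z; rewrite !inE; case Vz: (z \in V) => //=.
  have := eP x0 y0 Vx0 Vy0; rewrite /compl_rel xy0 nxy0 /= => /esym/eqP xy.
  by rewrite !eE // xy andbb.
pose nb x := [set z in V | e x z].
have nbE x y : x \in V -> y \in V -> (nb x == nb y) = ~~ e x y.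
  move=> Vx Vy; apply/eqP/idP => [/setP/(_ y)|nxy].
    by rewrite !inE Vy irr //= => ->.
  have [->//|xy] := eqVneq x y.
  have sub a b : a \in V -> b \in V -> a != b -> ~~ e a b -> nb a \subset nb b.
    move=> Va Vb ab nab.
    (* The common neighbours lie among the [K] neighbours of [a] and number [m = K], so they are all
       of them. *)
    have /setP E : [set z in V | e a z && e b z] = nb a.
      apply/eqP; rewrite eqEcard (hm a b) // (deg a) // mK leqnn andbT.
      by apply/subsetP => z; rewrite !inE => /and3P[-> ->].
    by apply/subsetP => z; rewrite -E !inE => /and3P[-> _ ->].
  by apply/eqP; rewrite eqEsubset !sub // 1?eq_sym // -(sym x y).
(* The cliques of the complement are the classes of equal neighbourhood; the class of [x] is [V]
   without the [K] neighbours of [x]. *)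
right; exists (preim_partition nb V), (N - K)%N.
have eqr : {in V & &, equivalence_rel (fun x y => nb x == nb y)}.
  by move=> x y z _ _ _; split=> // /eqP ->.
have part := preim_partitionP nb V; have /and3P[/eqP cov triv _] := part.
have blockE : {in V &, forall x y,
    (y \in pblock (preim_partition nb V) x) = ~~ e x y}.
  by move=> x y Vx Vy; rewrite pblock_equivalence_partition // nbE.
split=> // [B PB|x y Vx Vy]; last first.
  rewrite /compl_rel eq_pblock ?cov // blockE //.
have [x Bx] : exists x, x \in B.
  by apply/set0Pn; apply: contraTneq PB => ->; case/and3P: part.
have Vx : x \in V by rewrite -cov; apply/bigcupP; exists B.
have -> : B = V :\: nb x.
  apply/setP => y; rewrite -(def_pblock triv PB Bx) !inE.
  case Vy: (y \in V); first by rewrite blockE // andbT.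
  rewrite andbF; apply/negP => yB; case/negP: (negbT Vy); rewrite -cov.
  by apply/bigcupP; exists B; rewrite // -(def_pblock triv PB Bx).
rewrite cardsD (setIidPr _) ?cardV ?deg //.
by apply/subsetP => z; rewrite inE => /andP[].
Qed.

Lemma code0_zmod (F : numClosedFieldType) (R : finUnitRingType) (n : nat)
    (chi : R -> F) (C : {set 'rV[R]_n}) : generating_character chi ->
  linear_code C -> zmod_closed (code0 chi C).
Proof.
move=> h /linear_code_zmod[C0 CB]; split=> [|x y].
  rewrite inE C0; apply/eqP/(whomv_eq0 _ h) => j u _.
  by rewrite mxE mul0r additive_character0 //; case: h.
rewrite !inE => /andP[Cx /eqP wx] /andP[Cy /eqP wy].
by rewrite CB // whomvD0 ?whomvN ?wx ?wy ?eqxx.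
Qed.

Lemma whomv0 (F : numClosedFieldType) (R : finUnitRingType) (n : nat)
    (chi : R -> F) : generating_character chi -> whomv chi (0 : 'rV[R]_n) = 0.
Proof.
move=> h; apply/(whomv_eq0 _ h) => j u _.
by rewrite mxE mul0r additive_character0 //; case: h.
Qed.

Lemma code_coset_eq (F : numClosedFieldType) (R : finUnitRingType) (n : nat)
    (chi : R -> F) (C : {set 'rV[R]_n}) : generating_character chi ->
  linear_code C -> {in C &, forall c d,
    (code_coset chi C c == code_coset chi C d) = (whomv chi (c - d) == 0)}.
Proof.
move=> h Clin c d Cc Cd; have [C0 CB] := linear_code_zmod Clin.
have [Z0 ZB] := code0_zmod h Clin.
have ZN x : x \in code0 chi C -> - x \in code0 chi C by rewrite -sub0r; apply: ZB.
apply/eqP/eqP => [/setP/(_ c)|w0].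
  have -> : c \in code_coset chi C c by apply/imsetP; exists 0; rewrite ?addr0.
  case/esym/imsetP=> z; rewrite inE => /andP[_ /eqP z0] ->.
  by rewrite addrC addKr.
have Zcd : c - d \in code0 chi C by rewrite inE CB // w0 eqxx.
apply/setP => x; apply/imsetP/imsetP => -[z Zz ->].
  exists (z - (d - c)); last by rewrite opprB addrCA subrKC addrC.
  by rewrite ZB // -opprB ZN.
exists (z - (c - d)); first by rewrite ZB.
by rewrite opprB addrCA subrKC addrC.
Qed.

Lemma Gamma_adjE (F : numClosedFieldType) (R : finUnitRingType) (n : nat)
    (chi : R -> F) (C : {set 'rV[R]_n}) (w1 : F) : generating_character chi ->
  linear_code C -> {in C &, forall c d,
    Gamma_adj chi C w1 (code_coset chi C c) (code_coset chi C d)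
    = (whomv chi (c - d) == w1)}.
Proof.
move=> h Clin c d Cc Cd; apply/exists_inP/idP => [[a Ca]|w]; last first.
  by exists c => //; apply/exists_inP; exists d; rewrite // !eqxx.
case/exists_inP=> b Cb; rewrite !code_coset_eq // => /and3P[/eqP ca /eqP db].
move=> /eqP <-; apply/eqP.
have -> : c - d = a - b + (c - a) + (b - d) by rewrite (addrC (a - b)) !subrKA.
have bd : whomv chi (b - d) = 0 by rewrite -opprB whomvN.
by rewrite (whomvD0 _ h bd) (whomvD0 _ h ca).
Qed.

(** Every vertex is a translate of [code0] and a fibre of [code_coset]. The predicate [P] lets one
    statement convert the order, the degrees and the common-neighbour counts into counts of
    codewords. *)
Lemma card_Gamma_vertices (F : numClosedFieldType) (R : finUnitRingType)
    (n : nat) (chi : R -> F) (C : {set 'rV[R]_n}) (P : pred {set 'rV[R]_n}) :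
  generating_character chi -> linear_code C ->
  (#|[set B in Gamma_vertices chi C | P B]| * #|code0 chi C|
   = #|[set c in C | P (code_coset chi C c)]|)%N.
Proof.
move=> h Clin; have [C0 CB] := linear_code_zmod Clin.
rewrite -sum_nat_const -[RHS]sum1_card.
rewrite [RHS](partition_big (code_coset chi C)
  (fun B => B \in [set B in Gamma_vertices chi C | P B])) /=; last first.
  by move=> c; rewrite !inE => /andP[Cc ->]; rewrite andbT imset_f.
apply: eq_bigr => B; rewrite inE => /andP[/imsetP[c Cc ->] Pc].
rewrite -(card_imset _ (addrI c)) sum1dep_card; apply: eq_card => d.
rewrite [RHS]inE inE; apply/imsetP/andP => [[z]|[/andP[Cd _]]].
  rewrite inE => /andP[Cz /eqP z0] ->.
  have Ccz : c + z \in C by rewrite -[z]opprK -[- z]sub0r !CB.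
  have e : code_coset chi C (c + z) = code_coset chi C c.
    by apply/eqP; rewrite code_coset_eq // addrC addKr z0.
  by rewrite Ccz e Pc eqxx.
rewrite code_coset_eq // => dc.
by exists (d - c); rewrite ?subrKC // inE CB.
Qed.

(** * Parameters and triviality of the graph *)

Lemma modular_two_weight_equations (F : numClosedFieldType)
    (R : finUnitRingType) (chi : R -> F) (n : nat) (C : {set 'rV[R]_n})
    (w1 w2 : F) :
  generating_character chi -> (0 < n)%N -> modular C ->
  two_weight_code chi C w1 w2 ->
  let M : F := #|code0 chi C|%:R in
  let K : F := #|[set d in C | whomv chi d == w1]|%:R in
  let S c : F :=
    #|[set d in C | (whomv chi d == w1) && (whomv chi (c - d) == w1)]|%:R in
  (w2 - w1) * K = (w2 - n%:R) * #|C|%:R - w2 * M /\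
  {in C, forall c, w2 * (whomv chi c == w1)%:R * M + (w2 - w1) * S c
            + (n%:R - w2) * K
            = K * (n%:R - w1) / n%:R * (n%:R - whomv chi c)}.
Proof.
move=> h n0 [r Cr] [Clin w12 [w10 w20] wval].
(* The constant of [corr_conv] loses its factor [#|R^x|] because [n - w] is [corr] divided by
   [#|R^x|]. *)
apply: (two_weight_convolution (w := whomv chi) (rho := #|C|%:R * ratr r)) => //.
- exact: linear_code_zmod.
- by rewrite pnatr_eq0 -lt0n.
- by rewrite lt_eqF.
- exact: whomv0.
- by move=> c _; apply: whomvN.
- by move=> c d _ _; apply: whomvD0.
- move=> c Cc; have [->|wc] := eqVneq (whomv chi c) 0; first by left.
  by right; apply/(wval _ wc); exists c.
- rewrite (eq_bigr _ (fun d _ => whomv_corr d h)) -mulr_sumr corr_sum ?mulr0 //.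
  by case: Cr.
move=> c Cc; have U0 := card_runits_neq0 F R.
rewrite (eq_bigr (fun d =>
    (#|runits R|%:R)^-1 ^+ 2 * (corr chi d * corr chi (c - d)))).
  by rewrite -mulr_sumr (corr_conv h Clin Cr Cc) whomv_corr //; field.
by move=> d _; rewrite !whomv_corr //; ring.
Qed.

Theorem theorem12 (F : numClosedFieldType) (R : finUnitRingType)
    (hR : frobenius_ring F R)
    (chi : R -> F) (hchi : generating_character chi)
    (n : nat) (hn : (0 < n)%N)
    (C : {set 'rV[R]_n}) (w1 w2 : F)
    (hmod : modular C) (htw : two_weight_code chi C w1 w2) :
  (exists N K l m : nat,
     strongly_regular (Gamma_vertices chi C) (Gamma_adj chi C w1) N K l m /\
     [/\ N%:R = #|C|%:R / #|code0 chi C|%:R :> F,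
         K%:R = ((w2 - n%:R) * N%:R - w2) / (w2 - w1) :> F,
         l%:R = (K%:R * (w1 ^+ 2 / n%:R - 2%:R * w1) + w2 * (K%:R - 1))
                  / (w2 - w1) :> F &
         m%:R = (K%:R * (w1 * w2 / n%:R - w1 - w2) + w2 * K%:R)
                  / (w2 - w1) :> F]) /\
  (trivial_graph (Gamma_vertices chi C) (Gamma_adj chi C w1)
     <-> w1 = n%:R).
Proof.
have [eqK eqS] := modular_two_weight_equations hchi hn hmod htw.
have [Clin w12 [w10 w20] wval] := htw.
have [C0 CB] := linear_code_zmod Clin.
have [c1 Cc1 wc1] : exists2 c, c \in C & whomv chi c = w1.
  by apply/(wval _ w10); left.
have [c2 Cc2 wc2] : exists2 c, c \in C & whomv chi c = w2.
  by apply/(wval _ w20); right.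
set V := Gamma_vertices chi C; set e := Gamma_adj chi C w1.
pose co := code_coset chi C; pose w : 'rV[R]_n -> F := whomv chi.
have Vco c : c \in C -> co c \in V by move=> Cc; apply: imset_f.
have nF0 : n%:R != 0 :> F by rewrite pnatr_eq0 -lt0n.
have w21 : w2 - w1 != 0 by rewrite subr_eq0 gt_eqF.
have M0 : #|code0 chi C|%:R != 0 :> F.
  rewrite pnatr_eq0 -lt0n; apply/card_gt0P; exists 0.
  by case: (code0_zmod hchi Clin).
set M : F := #|code0 chi C|%:R in eqK eqS M0 *.
pose deg x := #|[set B in V | e x B]|.
pose com x y := #|[set B in V | e x B && e y B]|.
set K' : F := #|[set d in C | whomv chi d == w1]|%:R in eqK eqS.
pose S c : F :=
  #|[set d in C | (whomv chi d == w1) && (whomv chi (c - d) == w1)]|%:R.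
(* The reflection [z |-> c - z] carries the words in neighbours of the coset of [c] to the words of
   weight [w1]. *)
have degE c : c \in C -> (deg (co c))%:R * M = K'.
  move=> Cc; rewrite -natrM (card_Gamma_vertices _ hchi Clin).
  congr (_%:R); rewrite -(card_imset _ (inv_inj (subKr c))).
  apply: eq_card => d; rewrite [RHS]inE; apply/imsetP/andP.
    case=> z; rewrite inE => /andP[Cz]; rewrite /e Gamma_adjE // => wz ->.
    by rewrite CB.
  case=> Cd wd; exists (c - d); rewrite ?subKr // inE CB //=.
  by rewrite /e Gamma_adjE ?CB // subKr.
(* The same reflection sends [x] to [z = c - x]; then [(c - d) - z = x - d], of the same weight as
   [d - x]. *)
have comE c d : c \in C -> d \in C -> (com (co c) (co d))%:R * M = S (c - d).
  move=> Cc Cd; rewrite -natrM (card_Gamma_vertices _ hchi Clin).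
  congr (_%:R); rewrite -(card_imset _ (inv_inj (subKr c))).
  apply: eq_card => z; rewrite [RHS]inE; apply/imsetP/andP.
    case=> x; rewrite inE => /andP[Cx]; rewrite /e !Gamma_adjE //.
    move=> /andP[cx dx] ->; rewrite CB //; split=> //; rewrite cx.
    by rewrite opprB addrC subrKA -opprB whomvN.
  case=> Cz /andP[wz wcz]; exists (c - z); rewrite ?subKr // inE CB //=.
  rewrite /e !Gamma_adjE ?CB // subKr wz /= -whomvN //.
  by rewrite opprB addrAC.
(* The parameters are read off at the pairs [(c1, 0)], which is adjacent, and [(c2, 0)], which is
   not. *)
pose N := #|V|; pose K := deg (co 0); pose l := com (co c1) (co 0).
pose m := com (co c2) (co 0).
have NM : N%:R * M = #|C|%:R.
  rewrite -natrM; have := card_Gamma_vertices predT hchi Clin.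
  have -> : [set B in Gamma_vertices chi C | predT B] = V.
    by apply/setP => B; rewrite inE andbT.
  have -> : [set c in C | predT (code_coset chi C c)] = C.
    by apply/setP => c; rewrite inE andbT.
  by move=> <-.
have KM : K%:R * M = K' by apply: degE.
have cancelM x y : x * M = y * M -> x = y by apply: mulIf.
(* The convolution identity divided by [M]: the common-neighbour count depends only on the weight of
   [c - d]. *)
have comF c d : c \in C -> d \in C -> (com (co c) (co d))%:R * (w2 - w1)
    = K%:R * (n%:R - w1) / n%:R * (n%:R - w (c - d))
      - w2 * (w (c - d) == w1)%:R - (n%:R - w2) * K%:R.
  move=> Cc Cd; apply: cancelM; have := eqS _ (CB _ _ Cc Cd).
  rewrite -[X in (w2 - w1) * X]comE // -KM => eq.
  have -> : (com (co c) (co d))%:R * (w2 - w1) * M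
      = (w2 - w1) * ((com (co c) (co d))%:R * M) by ring.
  rewrite (_ : (w2 - w1) * _ = K%:R * M * (n%:R - w1) / n%:R * (n%:R - w (c - d))
      - w2 * (w (c - d) == w1)%:R * M - (n%:R - w2) * (K%:R * M)).
    by ring.
  by rewrite -eq; ring.
have KF : K%:R * (w2 - w1) = (w2 - n%:R) * N%:R - w2.
  by apply: cancelM; rewrite mulrBl -[_ * N%:R * M]mulrA NM -eqK -KM; ring.
have lF : l%:R * (w2 - w1)
    = K%:R * (n%:R - w1) / n%:R * (n%:R - w1) - w2 - (n%:R - w2) * K%:R.
  by rewrite comF // subr0 /w wc1 eqxx mulr1.
have mF : m%:R * (w2 - w1)
    = K%:R * (n%:R - w1) / n%:R * (n%:R - w2) - (n%:R - w2) * K%:R.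
  by rewrite comF // subr0 /w wc2 gt_eqF // mulr0 subr0.
have eE c d : c \in C -> d \in C -> e (co c) (co d) = (w (c - d) == w1).
  by move=> Cc Cd; apply: Gamma_adjE.
have srg : strongly_regular V e N K l m.
  split=> //.
  - split=> [_ _ /imsetP[c Cc ->] /imsetP[d Cd ->]|_ /imsetP[c Cc ->]].
      by rewrite !eE // /w -whomvN // opprB.
    by rewrite eE // subrr /w whomv0 // eq_sym (negPf w10).
  - move=> _ /imsetP[c Cc ->]; apply/eqP; rewrite -(eqr_nat F); apply/eqP.
    by apply: cancelM; rewrite KM degE.
  - move=> _ _ /imsetP[c Cc ->] /imsetP[d Cd ->]; rewrite eE // => /eqP wcd.
    apply/eqP; rewrite -(eqr_nat F); apply/eqP/(mulIf w21).
    by rewrite lF comF // wcd eqxx mulr1.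
  - move=> _ _ /imsetP[c Cc ->] /imsetP[d Cd ->]; rewrite eE // => ncd wcd.
    apply/eqP; rewrite -(eqr_nat F); apply/eqP/(mulIf w21).
    rewrite code_coset_eq // in ncd.
    have : w (c - d) = w1 \/ w (c - d) = w2.
      by apply/(wval _ ncd); exists (c - d); rewrite ?CB.
    case=> wE; first by rewrite wE eqxx in wcd.
    by rewrite mF comF // wE gt_eqF // mulr0 subr0.
have K0 : K%:R != 0 :> F.
  apply/eqP => K0; move/eqP: KM; rewrite K0 mul0r eq_sym pnatr_eq0 cards_eq0.
  by move/eqP/setP/(_ c1); rewrite !inE Cc1 wc1 eqxx.
(* If [w2 = n], then [KF] reads [K (n - w1) = - n], with a nonnegative left side and a negative
   right side. *)
have w2n : w2 != n%:R.
  apply/eqP => w2n; have := KF; rewrite w2n subrr mul0r sub0r => KE.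
  have : 0 <= K%:R * (n%:R - w1) by rewrite mulr_ge0 ?ler0n // subr_ge0 -w2n ltW.
  by rewrite KE oppr_ge0 lern0 => /eqP n0; rewrite n0 in hn.
(* In this factored form no factor on the right vanishes, hence [m != 0]. *)
have mF' : m%:R * (w2 - w1) = K%:R * w1 * (w2 - n%:R) / n%:R.
  by rewrite mF; field.
have m0 : m != 0%N.
  apply/eqP => m0; move/eqP: mF'; rewrite m0 mul0r eq_sym.
  rewrite !mulf_eq0 invr_eq0 subr_eq0.
  by rewrite (negPf K0) (negPf w10) (negPf w2n) (negPf nF0).
split.
  exists N, K, l, m; split=> //; split.
  - by rewrite -NM mulfK.
  - by rewrite -KF mulfK.
  - by apply: (canRL (mulfK w21)); rewrite lF; field.
  - by apply: (canRL (mulfK w21)); rewrite mF; field.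
rewrite (strongly_regular_trivial srg) //; last first.
  exists (co c2), (co 0); split; rewrite ?Vco //.
    by rewrite code_coset_eq // subr0 wc2.
  by rewrite eE // subr0 /w wc2 gt_eqF.
split=> [mK|w1n].
  (* Substituting [m = K] in [mF'] and clearing [n] leaves this product; [K] and [w2] are
     nonzero. *)
  have : K%:R * w2 * (w1 - n%:R) = 0.
    have E : K%:R * (w2 - w1) * n%:R = K%:R * w1 * (w2 - n%:R).
      by rewrite -[in LHS]mK mF' mulfVK.
    by apply/eqP; rewrite -(subrr (K%:R * (w2 - w1) * n%:R)) {1}E; apply/eqP; ring.
  move/eqP; rewrite !mulf_eq0 (negPf K0) (negPf w20) /= subr_eq0.
  by move/eqP.
apply/eqP; rewrite -(eqr_nat F); apply/eqP/(mulIf w21); rewrite mF' w1n.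
by field.
Qed.
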